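(* Let $e\ge 1$ and let $\mathcal{C}$ be an $e$-perfect mixed code of length $n$ over $Q=\mathbb{Z}_{q_1}\times\mathbb{Z}_{q_2}\times\cdots\times\mathbb{Z}_{q_n}$, where $q_i\le q_j$ for $i<j$. Then for each $t$ with $1\le t\le e+1$ and each subset $X$ of $[n]=\{1,\ldots,n\}$ of size $n-e+t-1$, $$\sum_{\substack{Y\subseteq X\\ |Y|=t}}\ \prod_{j\in Y}(q_j-1)\equiv 0\pmod{\binom{e+t}{t}}.$$
   Context: Here $q_1,\dots,q_n\ge 2$ are integers and $Q$ is viewed as the set of words of length $n$ whose $i$-th letter lies in $\mathbb{Z}_{q_i}$, with Hamming distance $d(\cdot,\cdot)$. An $e$-perfect mixed code over $Q$ is a set $\mathcal{C}\subseteq Q$ such that for each $x\in Q$ there is a unique $c\in\mathcal{C}$ with $d(x,c)\le e$. *)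

(* Defs.v *)
From mathcomp Require Import all_boot all_order all_algebra.

Set Implicit Arguments.
Unset Strict Implicit.
Unset Printing Implicit Defensive.

(* 'Z_m is the ring of integers modulo max(m, 2), so it is Z/mZ only when
   2 <= m; this has to be assumed of every q i. *)
Definition word (n : nat) (q : 'I_n -> nat) : finType :=
  {dffun forall i : 'I_n, 'Z_(q i)}.

Definition hamming_dist (n : nat) (q : 'I_n -> nat) (x y : word q) : nat :=
  #|[set i : 'I_n | x i != y i]|.

Definition perfect_mixed_code (n : nat) (q : 'I_n -> nat) (e : nat)
    (C : {set word q}) : Prop :=
  forall x : word q, exists! c : word q, c \in C /\ hamming_dist x c <= e.

(* Main.v *)
(** Fix a codeword [c0] and measure supports relative to it, so that any other
    codeword has weight at least [2e+1]. A word of weight [e+1] is then covered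
    by a unique codeword, which has weight [2e+1] and agrees with the word on its
    support. Fix nonzero letters on the complement of [X], which has
    [e+1-t] elements. The left-hand side counts the words of weight [e+1] with
    these letters; the codewords of weight [2e+1] with these letters have [e+t]
    further support points in [X], so each of them covers ['C(e+t, t)] of those
    words. *)
Require Import Defs.
From mathcomp Require Import all_boot all_order all_algebra.
From mathcomp Require Import zify.

Set Implicit Arguments.
Unset Strict Implicit.
Unset Printing Implicit Defensive.

Lemma subset_of_card (T : finType) (D : {set T}) (k : nat) :
  k <= #|D| -> exists2 A : {set T}, A \subset D & #|A| = k.
Proof.
move=> le_kD.
have : 0 < #|[set A : {set T} | A \subset D & #|A| == k]|.
  by rewrite cards_draws bin_gt0.
by case/card_gt0P=> A; rewrite inE => /andP[sAD /eqP cA]; exists A.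
Qed.

Section MixedWords.

Variables (n : nat) (q : 'I_n -> nat).
Implicit Types (c u v w x y : word q) (A D T X Y : {set 'I_n}).

Definition diff x y : {set 'I_n} := [set i | x i != y i].

Definition splice A x y : word q := [ffun i => if i \in A then x i else y i].

Lemma diff_splicel A x y : diff (splice A x y) x = diff y x :\: A.
Proof. by apply/setP => i; rewrite !inE ffunE; case: ifP; rewrite ?eqxx. Qed.

Lemma diff_splicer A x y : diff (splice A x y) y = diff x y :&: A.
Proof.
by apply/setP => i; rewrite !inE ffunE; case: ifP; rewrite ?eqxx ?andbT ?andbF.
Qed.

Lemma diffC x y : diff x y = diff y x.
Proof. by apply/setP => i; rewrite !inE eq_sym. Qed.

Lemma perfect_uniq e (C : {set word q}) x c c' :
  perfect_mixed_code e C -> c \in C -> c' \in C ->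
  #|diff x c| <= e -> #|diff x c'| <= e -> c = c'.
Proof.
move=> perfC Cc Cc' dc dc'; have [c1 [_ c1P]] := perfC x.
by rewrite -(c1P c) // -(c1P c').
Qed.

(** Otherwise a word midway between the two codewords would lie within [e] of both. *)
Lemma perfect_min_dist e (C : {set word q}) c c' :
  perfect_mixed_code e C -> c \in C -> c' \in C -> c != c' ->
  e.*2 < #|diff c c'|.
Proof.
move=> perfC Cc Cc'; apply: contraR; rewrite -leqNgt => le_d.
(* Taking [c] on half of the differing places, rounded down, and [c'] elsewhere leaves at most [e]
   differences on either side. *)
have /subset_of_card[A sA cA] : #|diff c c'|./2 <= #|diff c c'| by lia.
apply/eqP; apply: (@perfect_uniq e C (splice A c c')) => //.
  by rewrite diff_splicel diffC cardsDS // cA; lia.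
by rewrite diff_splicer (setIidPr sA) cA; lia.
Qed.

(** Disjointness says that the codeword agrees with [u] on the support of [u]. The codeword [c]
    within [e] of [u] has weight at most [(e+1) + e]; the minimum distance makes this an equality,
    which leaves no room for overlap. *)
Lemma perfect_cover e (C : {set word q}) c0 u :
  perfect_mixed_code e C -> c0 \in C -> #|diff u c0| = e.+1 ->
  exists c, [/\ c \in C, #|diff c c0| = e.*2.+1,
    [disjoint diff u c0 & diff u c]
    & forall c', c' \in C -> #|diff c' c0| = e.*2.+1 ->
        [disjoint diff u c0 & diff u c'] -> c' = c].
Proof.
move=> perfC Cc0 du; have [c [[Cc le_uc] _]] := perfC u.
have {le_uc} dc : #|diff u c| <= e by [].
have nc : c != c0 by apply: contraTneq dc => ->; rewrite du ltnn.
have dmin := perfect_min_dist perfC Cc Cc0 nc.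
have sub : diff c c0 \subset diff u c0 :|: diff u c.
  apply/subsetP => i; rewrite !inE; apply: contraR.
  by rewrite negb_or !negbK => /andP[/eqP <- /eqP <-].
have := subset_leq_card sub; rewrite cardsU => le_d.
have leI := subset_leq_card (subsetIl (diff u c0) (diff u c)).
exists c; split=> //; first lia.
  by rewrite -setI_eq0 -cards_eq0; apply/eqP; lia.
(* Any such [c'] differs from [u] only on its own support minus that of [u], so in at most
   [(2e+1) - (e+1) = e] places. *)
move=> c' Cc' dc' uc'; apply: (@perfect_uniq e C u) => //.
have suc' : diff u c0 \subset diff c' c0.
  apply/subsetP => i iu; have := disjointFr uc' iu.
  by move: iu; rewrite !inE => iu /negbFE/eqP <-.
have sub' : diff u c' \subset diff c' c0 :\: diff u c0.
  apply/subsetP => i iuc'; have /negbT iNu := disjointFl uc' iuc'.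
  rewrite in_setD iNu /=; move: iNu iuc'.
  by rewrite !inE negbK => /eqP ->; rewrite eq_sym.
by have := subset_leq_card sub'; rewrite cardsDS // dc' du; lia.
Qed.

(** The conditions decouple by coordinate: the letter of [w] is forced outside [X], that of [c0] on
    [X] minus [Y], and any letter but that of [c0] is allowed on [Y]. *)
Lemma card_words_supp c0 w X Y :
  (forall i, 2 <= q i) -> Y \subset X ->
  #|[set u | (diff u w \subset X) && (diff u c0 :&: X == Y)]|
    = \prod_(j in Y) (q j - 1).
Proof.
move=> q_ge2 sYX.
pose F i : pred 'Z_(q i) := fun a =>
  if i \in Y then a != c0 i else a == splice X c0 w i.
transitivity #|(family F : pred (word q))|.
  apply: eq_card => u; rewrite inE; apply/andP/familyP.
    case=> /subsetP uw /eqP/setP dY i; rewrite unfold_in /F.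
    have := dY i; have := uw i; rewrite ffunE !inE.
    case: (i \in X); case: (i \in Y); case: (u i == c0 i) => //= uwi _;
      by apply: contraT => /uwi.
  move=> uF; have dY i : (u i != c0 i) && (i \in X) = (i \in Y).
    have := uF i; rewrite unfold_in /F ffunE.
    have [iY ->|_] := boolP (i \in Y); first by rewrite (subsetP sYX).
    by case: ifP => [_ /eqP ->|]; rewrite ?eqxx ?andbF.
  split; last by apply/eqP/setP => i; rewrite !inE dY.
  apply/subsetP => i; rewrite !inE; apply: contraR => iNX.
  have := uF i; rewrite unfold_in /F ffunE (negbTE iNX).
  by case: ifP => // /(subsetP sYX); rewrite (negbTE iNX).
rewrite card_family foldrE big_map big_enum /= [RHS]big_mkcond /=.
apply: eq_bigr => i _; rewrite /F; case: ifP => _; last by rewrite card1.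
(* Here [2 <= q i] ensures that ['Z_(q i)] has exactly [q i] elements. *)
by rewrite (cardC1 (c0 i)) card_ord Zp_cast // subn1.
Qed.

Lemma card_words_weight c0 w X t :
  (forall i, 2 <= q i) ->
  #|[set u | (diff u w \subset X) && (#|diff u c0 :&: X| == t)]|
    = \sum_(Y : {set 'I_n} | (Y \subset X) && (#|Y| == t))
        \prod_(j in Y) (q j - 1).
Proof.
move=> q_ge2; rewrite -sum1_card.
rewrite (partition_big (fun u => diff u c0 :&: X)
  (fun Y : {set 'I_n} => (Y \subset X) && (#|Y| == t))) /=; last first.
  by move=> u; rewrite inE => /andP[_ ->]; rewrite subsetIr.
apply: eq_bigr => Y /andP[sYX cY]; rewrite -(card_words_supp c0 w q_ge2 sYX).
rewrite -sum1_card; apply: eq_bigl => u; rewrite !inE -andbA.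
by congr (_ && _); case: (_ =P Y) => [->|_]; rewrite ?cY ?eqxx ?andbF.
Qed.

(** Such a word is determined by its support [Y] inside [X]: it is [c] on [Y] and outside [X], where
    [c] agrees with [w], and [c0] elsewhere. Any [t]-subset [Y] of the support of [c] in [X]
    occurs. *)
Lemma card_words_covered c0 w c X s t :
  diff c w \subset X -> #|diff c c0 :&: X| = s ->
  #|[set u | [&& diff u w \subset X, #|diff u c0 :&: X| == t
               & [disjoint diff u c0 & diff u c]]]| = 'C(s, t).
Proof.
move=> cw <-; rewrite -cards_draws.
pose f Y := splice (~: X :|: Y) c c0.
have dfE Y : diff (f Y) c0 = diff c c0 :&: (~: X :|: Y) by apply: diff_splicer.
have dfX Y : Y \subset diff c c0 :&: X -> diff (f Y) c0 :&: X = Y.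
  move=> /subsetP sY; apply/setP=> i; rewrite dfE !inE.
  have := sY i; rewrite !inE.
  by case: (i \in Y); case: (i \in X); case: (c i != c0 i) => //= /(_ isT).
rewrite -(card_in_imset (f := f)); last first.
  move=> Y1 Y2; rewrite !inE => /andP[s1 _] /andP[s2 _] eq_f.
  by rewrite -(dfX Y1) // eq_f dfX.
apply: eq_card => u; rewrite inE; apply/and3P/imsetP.
  move=> [uw cu duc]; exists (diff u c0 :&: X).
    rewrite inE cu andbT; apply/subsetP => i; rewrite !inE => /andP[iu ->].
    have := disjointFr duc (_ : i \in diff u c0); rewrite !inE => /(_ iu).
    by move/negbFE/eqP <-; rewrite iu.
  apply/ffunP => i; rewrite ffunE !inE.
  have [iX|iNX] /= := boolP (i \in X); last first.
    have := subsetP uw i; have := subsetP cw i; rewrite !inE (negbTE iNX).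
    by case: eqP => [->|_ /(_ isT)] //; case: eqP => // _ _ /(_ isT).
  rewrite andbT; have := disjointFr duc (_ : i \in diff u c0); rewrite !inE.
  by case: (u i =P c0 i) => //= _ /(_ isT)/negbFE/eqP.
move=> [Y]; rewrite inE => /andP[sY cY] ->; rewrite dfX //; split=> //.
  apply/subsetP => i; rewrite inE ffunE; have := subsetP cw i; rewrite !inE.
  by case: (i \in X) => //= /contraNN; apply.
rewrite dfE diff_splicel -setI_eq0; apply/eqP/setP=> i; rewrite !inE.
by case: (i \in X); case: (i \in Y); rewrite ?andbF.
Qed.

(** The support of [u] contains the whole complement of [X]. For the [X] of the theorem, weights
    [e+1] and [2e+1] thus correspond to [t] and [e+t] support points in [X]. *)
Lemma card_diff_agree c0 w u X :
  diff w c0 = ~: X -> diff u w \subset X ->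
  #|diff u c0| + #|X| = #|diff u c0 :&: X| + n.
Proof.
move=> /setP dw /subsetP uw.
have duX : diff u c0 :\: X = ~: X.
  apply/setP=> i; rewrite -dw; have := dw i; have := uw i; rewrite !inE.
  case: (i \in X) => /=; first by move=> _ ->.
  by case: eqP => [-> _|_ /(_ isT)].
by have := cardsID X (diff u c0); rewrite duX; have := cardsC X;
  rewrite card_ord; lia.
Qed.

End MixedWords.

Theorem corollary3 (n : nat) (q : 'I_n -> nat) (e : nat) (C : {set word q})
  (q_ge2 : forall i : 'I_n, 2 <= q i)
  (q_mono : forall i j : 'I_n, i < j -> q i <= q j)
  (e_ge1 : 1 <= e)
  (perfC : perfect_mixed_code e C)
  (t : nat) (t_ge1 : 1 <= t) (t_le : t <= e + 1)
  (X : {set 'I_n}) (cardX : #|X| + e + 1 = n + t) :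
  \sum_(Y : {set 'I_n} | (Y \subset X) && (#|Y| == t))
     \prod_(j in Y) (q j - 1) = 0 %[mod 'C(e + t, t)].
Proof.
have [c0 [[Cc0 _] _]] := perfC [ffun i => 0%R].
(* Adding 1 supplies a letter different from that of [c0] at each place outside [X]. *)
pose w : word q := [ffun i => if i \in X then c0 i else (c0 i + 1)%R].
have dw : diff w c0 = ~: X.
  apply/setP=> i; rewrite !inE ffunE; case: ifP => _; first by rewrite eqxx.
  by rewrite -GRing.subr_eq0 GRing.addrC GRing.addKr GRing.oner_neq0.
pose U := [set u | (diff u w \subset X) && (#|diff u c0 :&: X| == t)].
pose K := [set c in C | (diff c w \subset X) && (#|diff c c0 :&: X| == e + t)].
pose cov (u c : word q) := [disjoint diff u c0 & diff u c].
have one_cover u : u \in U -> \sum_(c in K | cov u c) 1 = 1.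
  rewrite inE => /andP[uw /eqP du].
  have [|c [Cc dc uc c_uniq]] := perfect_cover (u := u) perfC Cc0.
    by have := card_diff_agree dw uw; rewrite du; lia.
  rewrite (big_pred1 c) // => c'; apply/andP/eqP => [[]|->].
    rewrite inE => /and3P[Cc' cw' /eqP dc'] uc'; apply: c_uniq => //.
    by have := card_diff_agree dw cw'; rewrite dc'; lia.
  (* Outside [X], [u] equals [w] and so differs from [c0]; there [c] agrees with [u]. *)
  have cw : diff c w \subset X.
    apply/subsetP => i; rewrite inE; apply: contraR => iNX.
    have /setP/(_ i) := dw; have := subsetP uw i; rewrite !inE iNX (negbTE iNX).
    have [uwi _ wi|_ /(_ isT)//] := eqVneq (u i) (w i).
    have := disjointFr uc (_ : i \in diff u c0); rewrite !inE uwi wi => /(_ isT).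
    by move/negbFE/eqP ->.
  split=> //; rewrite inE Cc cw /=; apply/eqP.
  by apply: (@addIn n); rewrite -(card_diff_agree dw cw) dc; lia.
rewrite -[\sum_(Y | _) _](card_words_weight c0 w X t q_ge2) -/U -sum1_card.
(* Double counting of the pairs of a word in [U] and the codeword in [K] covering it. *)
rewrite -(eq_bigr _ one_cover) (exchange_big_dep (mem K)) /=; last first.
  by move=> u c _ /andP[].
rewrite (eq_bigr (fun=> 'C(e + t, t))); last first.
  move=> c Kc; have /setIdP[_ /andP[cw /eqP dc]] := Kc.
  rewrite -(card_words_covered t cw dc) -[RHS]sum1_card.
  by apply: eq_bigl => u; rewrite Kc !inE -andbA.
by rewrite sum_nat_const modnMl mod0n.
Qed.
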